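(* Let $C$ be a commutative Noetherian ring and let $A$ be an affine $C$-algebra (finitely generated as an algebra over $C$) which is weakly representable. Then $A$ is Hopfian.
   Context: An algebra $A$ is \emph{weakly representable} if there is an injective ring homomorphism $A \hookrightarrow M_n(K)$ for some $n$ and some commutative ring $K$. A ring $A$ is \emph{Hopfian} if $A$ is not isomorphic (as a ring) to $A/J$ for any nonzero two-sided ideal $J \triangleleft A$. *)

(* Defs.v *)
From HB Require Import structures.
From mathcomp Require Import all_boot all_order all_algebra.
Set Implicit Arguments. Unset Strict Implicit. Unset Printing Implicit Defensive.
Import GRing.Theory.
Local Open Scope ring_scope.

Definition is_ideal (R : pzRingType) (J : R -> Prop) : Prop :=
  [/\ J 0,
      (forall x y, J x -> J y -> J (x + y)),
      (forall a x, J x -> J (a * x)) &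
      (forall a x, J x -> J (x * a))].

Definition noetherian (C : comPzRingType) : Prop :=
  forall I : nat -> C -> Prop,
    (forall k, is_ideal (I k)) ->
    (forall k x, I k x -> I k.+1 x) ->
    exists N, forall m, (N <= m)%N -> forall x, I m x -> I N x.

Definition generates_alg (C : comPzRingType) (A : algType C) (s : seq A) : Prop :=
  forall P : A -> Prop,
    P 1 ->
    (forall x y, P x -> P y -> P (x + y)) ->
    (forall x y, P x -> P y -> P (x * y)) ->
    (forall (c : C) x, P x -> P (c *: x)) ->
    (forall x, x \in s -> P x) ->
    forall x, P x.

Definition affine_alg (C : comPzRingType) (A : algType C) : Prop :=
  exists s : seq A, generates_alg s.

Definition weakly_representable (A : pzRingType) : Prop :=
  exists (K : comPzRingType) (n : nat) (f : {rmorphism A -> 'M[K]_n}),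
    injective f.

Definition is_quotient_map (A B : pzRingType) (J : A -> Prop)
    (pi : {rmorphism A -> B}) : Prop :=
  (forall b, exists a, pi a = b) /\ (forall a, pi a = 0 <-> J a).

Definition ring_isomorphic (A B : pzRingType) : Prop :=
  exists f : {rmorphism A -> B}, bijective f.

Definition hopfian (A : pzRingType) : Prop :=
  forall J : A -> Prop, is_ideal J -> (exists x, J x /\ x <> 0) ->
    forall (B : pzRingType) (pi : {rmorphism A -> B}),
      is_quotient_map J pi -> ~ ring_isomorphic A B.

(* Main.v *)
(**
If [A] is isomorphic to [A/J], then [A] has a surjective endomorphism [phi]
with kernel [J], and an embedding [f : A -> M_n(K)] gives representations
[f_i := f \o phi^i] whose kernels ascend.  It is enough that they stabilize.
The difficulty is that [f_i] need not map [C] to scalar matrices.  Let the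
polynomial ring [R := C[x_(j,p,q)]] act on [K^n] through [f_i] on [C] and by
[x_(j,p,q)] acting as the scalar [(f_i a_j)_(q,p)], where the [a_j] generate [A];
this is possible because [f_i C] commutes with [f_i A].  Each [a] in [A] then
lifts to a matrix [M] over [R], independent of [i], with
[f_i a * e_p = \sum_q M_(p,q) e_q] for all [i] and [p].  Hence [ker f_i] is
determined by the submodule of [R^n] spanned by the rows of the lifts of its
elements, and these submodules stabilize because [R] is Noetherian.
*)
Require Import Defs.
From HB Require Import structures.
From mathcomp Require Import all_boot all_order all_algebra.

Set Implicit Arguments.
Unset Strict Implicit.
Unset Printing Implicit Defensive.
Import GRing.Theory.
Local Open Scope ring_scope.

(** * Submodules and ascending chains *)

Definition is_submodule (R : pzRingType) (V : lmodType R) (N : V -> Prop) :=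
  [/\ N 0, forall u v, N u -> N v -> N (u + v) & forall a v, N v -> N (a *: v)].

Definition ascending T (I : nat -> T -> Prop) := forall k x, I k x -> I k.+1 x.

Definition stationary T (I : nat -> T -> Prop) :=
  exists N, forall m, (N <= m)%N -> forall x, I m x -> I N x.

Lemma ascending_le T (I : nat -> T -> Prop) : ascending I ->
  forall j k, (j <= k)%N -> forall x, I j x -> I k x.
Proof.
move=> Iinc j k /subnK <-; elim: (k - j)%N => [|d IHd] x // Ix.
by rewrite addSn; apply/Iinc/IHd.
Qed.

Lemma stationary_finite T (I : nat -> nat -> T -> Prop) (D : nat) :
  (forall d, ascending (I d)) -> (forall d, stationary (I d)) ->
  exists M, forall d, (d < D)%N ->
    forall m, (M <= m)%N -> forall x, I d m x -> I d M x.
Proof.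
move=> Iinc Istat; elim: D => [|D [M IHM]]; first by exists 0%N.
have [M' HM'] := Istat D; exists (maxn M M') => d.
rewrite ltnS leq_eqVlt => /orP[/eqP->|ltdD] m; rewrite geq_max => /andP[leM leM'] x Ix.
  by apply: (ascending_le (Iinc D) (leq_maxr M M')); apply: HM' Ix.
by apply: (ascending_le (Iinc d) (leq_maxl M M')); apply: IHM Ix.
Qed.

(** * Leading coefficients: Hilbert's basis theorem and chains of submodules of [R^n] *)

Section LeadingCoefficients.
Variable R : comNzRingType.
Implicit Types (p q : {poly R}) (N : {poly R} -> Prop).

(** Bounding the size, instead of fixing the degree, admits 0 as a leading coefficient and gives
    closure under addition. *)
Definition coef_ideal N d (c : R) :=
  exists p, [/\ N p, (size p <= d.+1)%N & p`_d = c].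

Lemma coef_ideal_is_ideal N d : is_submodule N -> is_ideal (coef_ideal N d).
Proof.
case=> N0 ND NZ.
have coefZ_closed a c : coef_ideal N d c -> coef_ideal N d (a * c).
  case=> p [Np szp <-]; exists (a *: p); split; first exact: NZ.
    exact: leq_trans (size_scale_leq _ _) szp.
  by rewrite coefZ.
split=> //.
- by exists 0; rewrite size_poly0 coef0.
- move=> _ _ [p [Np szp <-]] [q [Nq szq <-]]; exists (p + q).
  split; [exact: ND | | by rewrite coefD].
  by rewrite (leq_trans (size_polyD _ _)) // geq_max szp.
- by move=> a c /coefZ_closed; rewrite mulrC; apply.
Qed.

Lemma coef_ideal_sub N N' d :
  (forall p, N p -> N' p) -> forall c, coef_ideal N d c -> coef_ideal N' d c.
Proof. by move=> sNN' c [p [Np szp <-]]; exists p; split=> //; apply: sNN'. Qed.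

(** Subtracting from [p] an element of [N] with the same top coefficient lowers the size and stays
    in [N'], so induction on the size applies. Working with [R]-submodules covers both ideals of
    [{poly R}] and submodules of [R^n]. *)
Lemma submodule_coef_ideal_sub N N' : is_submodule N -> is_submodule N' ->
    (forall p, N p -> N' p) ->
    (forall d c, coef_ideal N' d c -> coef_ideal N d c) ->
  forall p, N' p -> N p.
Proof.
move=> [N0 ND _] [_ N'D N'Z] sNN' sLL' p; move: {2}(size p) (leqnn (size p)) => s.
elim: s p => [|s IHs] p; first by rewrite size_poly_leq0 => /eqP->.
move=> szp N'p; have [|q [Nq szq qs]] := sLL' s p`_s; first by exists p.
rewrite -(subrK q p); apply: ND => //; apply: IHs; last first.
  by rewrite -scaleN1r; apply: N'D => //; apply/N'Z/sNN'.
apply/leq_sizeP => j; rewrite leq_eqVlt => /orP[/eqP<-|ltsj].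
  by rewrite coefB qs subrr.
by rewrite coefB !nth_default ?subrr // (leq_trans _ ltsj).
Qed.

Lemma hilbert_basis : noetherian R -> noetherian {poly R}.
Proof.
move=> noethR I Iideal Iinc.
have Isub k : is_submodule (I k).
  have [I0 ID Il _] := Iideal k; split=> // a p Ip.
  by rewrite -mul_polyC; apply: Il.
pose L d k := coef_ideal (I k) d.
have Linc d : ascending (L d) by move=> k; apply: coef_ideal_sub; apply: Iinc.
have LX d k c : L d k c -> L d.+1 k c.
  case=> p [Ip szp <-]; exists (p * 'X); rewrite coefMX; split=> //.
    by have [_ _ _] := Iideal k; apply.
  by rewrite (leq_trans (size_polyMleq _ _)) // size_polyX addn2.
have Lle d d' k : (d <= d')%N -> forall c, L d k c -> L d' k c.
  move/subnK<-; elim: (d' - d)%N => [|e IHe] c // Lc.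
  by rewrite addSn; apply/LX/IHe.
have Lideal d k : is_ideal (L d k) by apply: coef_ideal_is_ideal.
(* The diagonal chain [L k k] controls all degrees [d >= D] at once; the finitely many degrees below
   [D] are treated one by one. *)
have [D HD] := noethR _ (fun k => Lideal k k) (fun k x Lx => LX _ _ _ (Linc _ _ _ Lx)).
have [M0 HM0] := @stationary_finite _ L D Linc (fun d => noethR _ (Lideal d) (Linc d)).
exists (maxn D M0) => m leMm; apply: submodule_coef_ideal_sub => // [p|d c Lc].
  exact: (ascending_le Iinc leMm).
move: leMm; rewrite geq_max => /andP[leDm leM0m]; case: (ltnP d D) => [ltdD|leDd].
  by apply: (ascending_le (Linc d) (leq_maxr D M0)); apply: HM0 Lc.
apply: (ascending_le (Linc d) (leq_maxl D M0)); apply: (Lle _ _ _ leDd).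
apply: (HD (maxn d m)); first by rewrite leq_max leDd.
by apply: (Lle d _ _ (leq_maxl _ _)); apply: (ascending_le (Linc d) (leq_maxr d m)).
Qed.

(** Row vectors are read as polynomials of size at most [n], so only the coefficient ideals of
    degree below [n] matter. *)
Lemma submodule_rV_stationary n (N : nat -> 'rV[R]_n -> Prop) : noetherian R ->
  (forall k, is_submodule (N k)) -> ascending N -> stationary N.
Proof.
move=> noethR Nsub Ninc.
pose I k p := (size p <= n)%N /\ N k (poly_rV p).
have Isub k : is_submodule (I k).
  have [N0 ND NZ] := Nsub k; split.
  - by rewrite /I size_poly0 linear0.
  - move=> p q [szp Np] [szq Nq]; split; last by rewrite linearD; apply: ND.
    by rewrite (leq_trans (size_polyD _ _)) // geq_max szp.
  - move=> a p [szp Np]; split; last by rewrite linearZ; apply: NZ.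
    exact: leq_trans (size_scale_leq _ _) szp.
have Iinc : ascending I by move=> k p [szp /Ninc].
pose L d k := coef_ideal (I k) d.
have Linc d : ascending (L d) by move=> k; apply: coef_ideal_sub; apply: Iinc.
have Lideal d k : is_ideal (L d k) by apply: coef_ideal_is_ideal.
have [M HM] := @stationary_finite _ L n Linc (fun d => noethR _ (Lideal d) (Linc d)).
exists M => m leMm v Nv.
suff: I M (rVpoly v) by case=> _; rewrite rVpolyK.
apply: (@submodule_coef_ideal_sub _ (I m)) => // [p|d c Lc|].
- exact: (ascending_le Iinc leMm).
- case: (ltnP d n) => [ltdn|lend]; first exact: HM Lc.
  case: Lc => p [[szp _] _ <-]; rewrite nth_default ?(leq_trans szp) //.
  by have [] := Lideal d M.
- by split; rewrite ?rVpolyK // size_poly.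
Qed.

End LeadingCoefficients.

(** * Polynomial rings in finitely many variables *)

Lemma noetherian_polynomial_extension (C : comPzRingType) (m : nat) :
    (1 : C) != 0 -> noetherian C ->
  exists (R : comNzRingType) (iota : C -> R) (x : nat -> R), noetherian R /\
    forall (E : pzRingType) (h : {rmorphism C -> E}) (e : nat -> E),
      (1 : E) != 0 ->
      (forall i j, GRing.comm (e i) (e j)) ->
      (forall i c, GRing.comm (e i) (h c)) ->
    exists g : {rmorphism R -> E}, [/\ forall c, g (iota c) = h c,
      forall i, (i < m)%N -> g (x i) = e i &
      forall z, (forall c, GRing.comm z (h c)) -> (forall i, GRing.comm z (e i)) ->
        forall r, GRing.comm z (g r)].
Proof.
move=> nzC noethC; elim: m => [|m [R [iota [x [noethR univ]]]]].
  pose C1 : comNzRingType := HB.pack C (GRing.PzSemiRing_isNonZero.Build C nzC).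
  exists C1, id, (fun _ => 0); split=> // E h e _ _ _.
  by exists h; split.
exists {poly R}, (fun c => (iota c)%:P).
exists (fun i => if i == m then 'X else (x i)%:P); split.
  exact: hilbert_basis.
move=> E h e nzE ee eh; have [g [g_iota g_x g_comm]] := univ E h e nzE ee eh.
pose E1 : nzRingType := HB.pack E (GRing.PzSemiRing_isNonZero.Build E nzE).
pose g1 : {rmorphism R -> E1} := g.
(* [E] need not be commutative: the centralizer clause, carried through the induction, is what
   permits evaluation at [e m]. *)
have cg : commr_rmorph g1 (e m : E1) by apply: g_comm.
pose G : {rmorphism {poly R} -> E1} := horner_morph cg.
have GC r : G r%:P = g r by apply: horner_morphC.
have GX : G 'X = e m by apply: horner_morphX.
exists (G : {rmorphism {poly R} -> E}); split=> [c|i|z zh ze p].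
- by rewrite /= GC.
- rewrite ltnS leq_eqVlt => /orP[/eqP->|ltim]; first by rewrite eqxx.
  by rewrite (ltn_eqF ltim) GC g_x.
elim/poly_ind: p => [|p c IHp]; first by rewrite rmorph0; apply: commr0.
rewrite rmorphD rmorphM GX GC; apply: commrD; last exact: g_comm.
by apply: commrM.
Qed.

(** * Lifting matrices over [K] to matrices over [R] *)

Section Lifts.
Variables (R : comNzRingType) (K : comPzRingType) (n : nat).
Variable g : {rmorphism R -> 'M[K]_n}.

(** The [R]-linear map from [R^n] to [K^n] matching the standard bases, where [R] acts on [K^n]
    through [g]. *)
Definition act_rV (v : 'rV[R]_n) : 'cV[K]_n :=
  \sum_q g (v 0 q) *m delta_mx q 0.

Lemma act_rV_kernel : is_submodule (fun v => act_rV v = 0).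
Proof.
split=> [|u v u0 v0|a v v0]; rewrite /act_rV.
- by rewrite big1 // => q _; rewrite mxE rmorph0 mul0mx.
- transitivity (act_rV u + act_rV v); last by rewrite u0 v0 addr0.
  by rewrite -big_split; apply: eq_bigr => q _; rewrite mxE rmorphD mulmxDl.
- transitivity (g a *m act_rV v); last by rewrite v0 mulmx0.
  by rewrite mulmx_sumr; apply: eq_bigr => q _; rewrite mxE rmorphM mulmxA.
Qed.

Definition lifts (b : 'M[K]_n) (M : 'M[R]_n) :=
  forall p, act_rV (row p M) = b *m delta_mx p 0.

Lemma lifts1 : lifts 1 1.
Proof.
move=> p; rewrite /act_rV (bigD1 p) //= big1 ?addr0.
  by rewrite !mxE eqxx rmorph1.
by move=> q neqp; rewrite !mxE eq_sym (negPf neqp) rmorph0 mul0mx.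
Qed.

Lemma liftsD b b' M M' : lifts b M -> lifts b' M' -> lifts (b + b') (M + M').
Proof.
move=> bM bM' p; rewrite mulmxDl -bM -bM' -big_split; apply: eq_bigr => q _.
by rewrite !mxE rmorphD mulmxDl.
Qed.

Lemma liftsZ a b M : lifts b M -> lifts (g a *m b) (a *: M).
Proof.
move=> bM p; rewrite -mulmxA -bM mulmx_sumr; apply: eq_bigr => q _.
by rewrite !mxE rmorphM mulmxA.
Qed.

(* The factors are swapped since the rows of [M] evaluate to the columns of [b]. *)
Lemma liftsM b b' M M' : (forall r, GRing.comm b (g r)) ->
  lifts b M -> lifts b' M' -> lifts (b * b') (M' *m M).
Proof.
move=> bg bM bM' p; rewrite -mulmxA -bM' mulmx_sumr.
transitivity (\sum_q \sum_s g (M' p s * M s q) *m delta_mx q 0 : 'cV[K]_n).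
  by apply: eq_bigr => q _; rewrite !mxE rmorph_sum mulmx_suml.
rewrite exchange_big; apply: eq_bigr => s _ /=.
rewrite mulmxA [b *m _]bg -mulmxA -bM mulmx_sumr.
by apply: eq_bigr => q _; rewrite !mxE rmorphM mulmxA.
Qed.

Lemma lifts_scalar (b : 'M[K]_n) (M : 'M[R]_n) :
  (forall p q, g (M p q) = (b q p)%:M) -> lifts b M.
Proof.
move=> gM p; apply/colP => i; rewrite /act_rV summxE -colE mxE
  (bigD1 i) //= big1 => [|q neqi].
  by rewrite addr0 [row p M 0 i]mxE gM mul_scalar_mx !mxE !eqxx mulr1.
by rewrite [row p M 0 q]mxE gM mul_scalar_mx !mxE eq_sym (negPf neqi) mulr0.
Qed.

Lemma lifts_kernel b M : lifts b M -> (forall p, act_rV (row p M) = 0) -> b = 0.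
Proof.
move=> bM M0; apply/matrixP => i p; rewrite mxE.
by have := congr1 (fun u : 'cV_n => u i 0) (bM p); rewrite M0 -colE !mxE.
Qed.

End Lifts.

(** * Stabilization of the kernels of representations *)

Definition submodule_span (R : pzRingType) (V : lmodType R) (S : V -> Prop) v :=
  forall N : V -> Prop, is_submodule N -> (forall u, S u -> N u) -> N v.

Lemma submodule_span_is_submodule (R : pzRingType) (V : lmodType R)
  (S : V -> Prop) : is_submodule (submodule_span S).
Proof.
split=> [N []|u v Su Sv N Nsub SN|a v Sv N Nsub SN] //; have [_ ND NZ] := Nsub.
  by apply: ND; [apply: Su | apply: Sv].
by apply: NZ; apply: Sv.
Qed.

Theorem representation_kernels_stationary (C : comPzRingType) (A : algType C)
    (n : nat) (K : nat -> comPzRingType)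
    (f : forall k, {rmorphism A -> 'M[K k]_n}) :
    noetherian C -> affine_alg A -> (forall k, (1 : 'M[K k]_n) != 0) ->
    ascending (fun k a => f k a = 0) ->
  stationary (fun k a => f k a = 0).
Proof.
move=> noethC [s gen_s] nzM f_inc.
have nzC : (1 : C) != 0.
  apply: contra (nzM 0%N) => /eqP C0.
  by rewrite -(rmorph1 (f 0%N)) -(scale1r (1 : A)) C0 scale0r rmorph0.
pose T := ('I_(size s) * 'I_n * 'I_n)%type.
have [R [iota [x [noethR univ]]]] :=
  noetherian_polynomial_extension #|{: T}| nzC noethC.
pose h k : {rmorphism C -> 'M[K k]_n} := f k \o in_alg A.
(* The index [(j, p, q)] selects entry [(q, p)], since rows of a lift correspond to columns of the
   matrix. *)
pose entry k (t : T) : 'M[K k]_n := (f k s`_t.1.1 t.2 t.1.2)%:M.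
(* The default 0 outside the range keeps every [e k i] scalar, hence central. *)
pose e k i : 'M[K k]_n := oapp (entry k) 0 (omap enum_val (insub i : option 'I_#|{: T}|)).
have e_comm k i z : GRing.comm z (e k i).
  rewrite /e; case: (omap _ _) => [t|] /=; last exact: commr0.
  exact: scalar_mxC.
have h_comm k a c : GRing.comm (f k a) (h k c).
  by rewrite /GRing.comm /h /= -!rmorphM; congr (f k _); apply/esym/comm_alg.
have /= g_ex k := univ _ (h k) (e k) (nzM k) (fun i j => e_comm k j _)
  (fun i c => esym (e_comm k i (h k c))).
(* Quantifying over [k] inside [L] makes a single [M] serve all the representations. *)
pose L a M := forall k (g : {rmorphism R -> 'M[K k]_n}),
    (forall c, g (iota c) = h k c) -> (forall i, (i < #|{: T}|)%N -> g (x i) = e k i) ->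
    (forall b r, GRing.comm (f k b) (g r)) -> lifts g (f k a) M.
have a_lift a : exists M, L a M.
  apply: (gen_s (fun a => exists M, L a M)) =>
    {a} [|a b [Ma aMa] [Mb bMb]|a b [Ma aMa] [Mb bMb]|c a [M aM]|a].
  - by exists 1%:M => k g *; rewrite rmorph1; apply: lifts1.
  - exists (Ma + Mb) => k g g1 g2 g3; rewrite rmorphD.
    by apply: liftsD; [apply: aMa | apply: bMb].
  - exists (Mb *m Ma) => k g g1 g2 g3; rewrite rmorphM.
    by apply: liftsM; [apply: g3 | apply: aMa | apply: bMb].
  - exists (iota c *: M) => k g g1 g2 g3; rewrite -mulr_algl rmorphM.
    have -> : f k c%:A = g (iota c) by rewrite g1.
    by apply: liftsZ; apply: aM.
  - rewrite -index_mem => lt_a.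
    exists (\matrix_(p, q) x (enum_rank ((Ordinal lt_a, p, q) : T))) => k g g1 g2 g3.
    apply: lifts_scalar => p q; rewrite mxE g2 // /e valK /= enum_rankK /entry /=.
    by rewrite nth_index // -index_mem.
pose N k := submodule_span (fun v => exists a M p, [/\ f k a = 0, L a M & v = row p M]).
have [D HD] : stationary N.
  apply: submodule_rV_stationary => // [k|k v Nv P Psub SP].
    exact: submodule_span_is_submodule.
  apply: Nv => // _ [a [M [p [a0 aM ->]]]]; apply: SP.
  by exists a, M, p; split=> //; apply: f_inc.
exists D => m leDm a a0; have [M aM] := a_lift a.
have [g [g1 g2 g3]] := g_ex D.
have gf b r : GRing.comm (f D b) (g r) by apply: g3 => *; [apply: h_comm | apply: e_comm].
apply: (lifts_kernel (aM D g g1 g2 gf)) => p.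
have ND : N D (row p M).
  by apply: (HD m) => // P _; apply; exists a, M, p.
(* The span [N D] is killed by [act_rV g]: a generating row, from a lift of some [b] in the kernel
   of [f D], evaluates to a column of [f D b = 0]. *)
apply: (ND (fun v => act_rV g v = 0)) => [|{ND}]; first exact: act_rV_kernel.
move=> _ [b [M' [q [b0 bM' ->]]]].
by rewrite (bM' D g g1 g2 gf) b0 mul0mx.
Qed.

(** * From stationary kernels to the Hopfian property *)

Theorem mainTheorem7 (C : comPzRingType) (A : algType C) :
  noetherian C -> affine_alg A -> weakly_representable A -> hopfian A.
Proof.
move=> noethC affA [K [n [f f_inj]]] J _ [z [Jz nz_z]] B pi [pi_surj pi_ker].
case=> s [s' sK s'K].
have s'_add : nmod_morphism s' by apply: can2_nmod_morphism sK s'K.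
have s'_mul : monoid_morphism s' by apply: can2_monoid_morphism sK s'K.
pose s'1 : {rmorphism B -> A} :=
  HB.pack s' (GRing.isNmodMorphism.Build B A s' s'_add)
    (GRing.isMonoidMorphism.Build B A s' s'_mul).
pose phi : {rmorphism A -> A} := s'1 \o pi.
have phi_surj a : exists b, phi b = a.
  by have [b pib] := pi_surj (s a); exists b; rewrite /= pib sK.
pose F k : {rmorphism A -> 'M[K]_n} :=
  f \o iter k (fun h : {rmorphism A -> A} => phi \o h : {rmorphism A -> A}) idfun.
have FE k a : F k a = f (iter k phi a).
  by rewrite /F /=; congr (f _); elim: k => //= k ->.
have F0 k a : F k a = 0 <-> iter k phi a = 0.
  by rewrite FE; split=> [/eqP|->]; rewrite ?rmorph0 // -(rmorph0 f) => /eqP/f_inj.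
have nzM : (1 : 'M[K]_n) != 0.
  apply/eqP => M0; case: nz_z; apply: f_inj.
  by rewrite rmorph0 -[f z]mul1r M0 mul0r.
have F_inc : ascending (fun k a => F k a = 0).
  by move=> k a /F0 a0; apply/F0; rewrite iterS a0 rmorph0.
have [N HN] := @representation_kernels_stationary C A n _ F noethC affA (fun=> nzM) F_inc.
(* As [z] lies in the kernel [J] of [phi], [phi^(N+1)] kills such a [y]; stationarity at [N] then
   forces [z = phi^N y = 0]. *)
have [y yz] : exists y, iter N phi y = z.
  elim: N z {HN Jz nz_z} => [|N IHN] z; first by exists z.
  by have [b <-] := phi_surj z; have [y <-] := IHN b; exists y.
case: nz_z; rewrite -yz; apply/F0/(HN N.+1) => //; apply/F0.
by rewrite iterS yz /= (iffRL (pi_ker z) Jz); apply: (rmorph0 s'1).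
Qed.
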